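(* Let $\beta\ge1$ and let $x^1,\dots,x^T$ be revealed online with each $x^t\in K_t$ ($x^0=0$). For any $\delta>0$ and $\alpha\ge1$ there is a randomized dynamic rounding scheme maintaining spanning trees $H^t=(V,E_H^t)$ of $G^t$ such that \[\mathbb E\left[\sum_{t\in[T]}|E_H^t\oplus E_H^{t-1}|\right]\le O\!\left(\frac{\alpha\log n}{\delta^2}\right)\sum_{t\in[T]}\|x^t-x^{t-1}\|_1+O\!\left(\frac{T}{n^\alpha}\right),\] and $c(H^t)\le(2+\delta)\sum_{e\in E^t}c_ex_e^t$ for all $t\in[T]$.
   Context: Dynamic MST: vertex set $V$, $|V|=n$, costs $c_e\ge0$ on potential edges $e\in\binom V2$; at each time $t$ an edge is inserted into or deleted from $E$, giving a connected graph $G^t=(V,E^t)$. $\mathrm{OPT}^t$ is the minimum cost of a spanning tree of $G^t$; $c(H)=\sum_{e\in E_H}c_e$. For $\emptyset\subsetneq S\subsetneq V$, $\partial^t(S)$ is the set of edges of $G^t$ crossing $S$. $K_t=\{x\in\mathbb{R}_+^{\binom V2}:\sum_{e\in\partial^t(S)}x_e\ge1\ \forall\emptyset\subsetneq S\subsetneq V,\ x_e=0\ \forall e\notin E^t,\ \sum_{e\in E^t}c_ex_e\le\beta\,\mathrm{OPT}^t\}$. A dynamic rounding scheme chooses $H^t$ based only on $x^1,\dots,x^t$ and its randomness; $\oplus$ is symmetric difference.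
   Formalization: The constants in the two O's are uniform only for δ in (0, Δ], with Δ > 0 arbitrary: absolute constants for all δ > 0 are impossible, since for T = 1 with x^1 the indicator of a minimum spanning tree the recourse is n − 1 while the bound tends to O(1/n^α) as δ grows. *)

(* Defs.v *)
From HB Require Import structures.
From mathcomp Require Import all_boot all_order all_algebra.
From mathcomp Require Import all_classical all_reals all_analysis.

Set Implicit Arguments.
Unset Strict Implicit.
Unset Printing Implicit Defensive.
Import Order.TTheory GRing.Theory Num.Theory.
Local Open Scope ring_scope.

(* binom(V,2): the unordered pairs of distinct vertices. *)
Record pedge (V : finType) := Pedge {
  pedge_val : {set V};
  pedge_card : #|pedge_val| == 2%N
}.
HB.instance Definition _ (V : finType) := [isSub for @pedge_val V].
HB.instance Definition _ (V : finType) := [Finite of pedge V by <:].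

Section Graphs.
Context {R : realType} {V : finType}.
Implicit Types (E F : {set pedge V}) (S : {set V}) (c : pedge V -> R).

Definition adj E : rel V :=
  [rel u v | [exists e in E, \val e == [set u; v]%SET]].

Definition graph_connected E : Prop := forall u v : V, connect (adj E) u v.

(* [ucycle] also accepts u, v, u (traversing one edge back and forth), whose
   vertex list has size 2; genuine cycles have at least 3 vertices. *)
Definition graph_acyclic E : Prop :=
  forall p : seq V, ucycle (adj E) p -> (size p <= 2)%N.

Definition spanning_tree E F : Prop :=
  [/\ F \subset E, graph_connected F & graph_acyclic F].

Definition cut E S : {set pedge V} :=
  [set e in E | [exists u in S, exists v in ~: S, \val e == [set u; v]]]%SET.

Definition cost c F : R := \sum_(e in F) c e.

(* An infimum over a finite set of reals, hence a minimum as soon as E has a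
   spanning tree. *)
Definition OPT c E : R :=
  inf [set cost c F | F in [set F | spanning_tree E F]]%classic.

Definition fractional_cost c E (x : {ffun pedge V -> R}) : R :=
  \sum_(e in E) c e * x e.

Definition K c (beta : R) E : set {ffun pedge V -> R} :=
  [set x : {ffun pedge V -> R} | [/\ forall e, 0 <= x e,
      forall S, finset.set0 \proper S -> S \proper [set: V]%SET ->
        1 <= \sum_(e in cut E S) x e,
      forall e, e \notin E -> x e = 0 &
      fractional_cost c E x <= beta * OPT c E]]%classic.

Definition l1norm (x : {ffun pedge V -> R}) : R := \sum_e `|x e|.

Definition symdiff E F : {set pedge V} := ((E :\: F) :|: (F :\: E))%SET.

(* E' results from E by a single edge insertion or a single edge deletion. *)
Definition edge_update E E' : Prop :=
  exists e, (e \notin E /\ E' = (e |: E)%SET) \/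
            (e \in E /\ E' = (E :\ e)%SET).

End Graphs.

(* [scheme_run omega [:: x^1; ...; x^t]] is E_H^t: the scheme sees the prefix of
   the sequence and a random seed omega whose law does not depend on the
   sequence. *)
Record rounding_scheme (R : realType) (V : finType) := RoundingScheme {
  scheme_disp : measure_display;
  scheme_space : measurableType scheme_disp;
  scheme_prob : probability scheme_space R;
  scheme_run : scheme_space -> seq {ffun pedge V -> R} -> {set pedge V};
  scheme_measurable : forall (h : seq {ffun pedge V -> R}) (F : {set pedge V}),
    measurable [set omega | scheme_run omega h = F]%classic
}.

(* E_H^t on the sequence x, with the convention that E_H^0 is empty. *)
Definition maintained (R : realType) (V : finType) (A : rounding_scheme R V)
    (x : nat -> {ffun pedge V -> R}) (omega : scheme_space A) (t : nat) :
    {set pedge V} :=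
  if t is 0%N then finset.set0
  else scheme_run omega [seq x i | i <- iota 1 t].

Definition recourse (R : realType) (V : finType) (A : rounding_scheme R V)
    (x : nat -> {ffun pedge V -> R}) (T : nat) (omega : scheme_space A) : R :=
  (\sum_(1 <= t < T.+1)
     #|symdiff (maintained x omega t) (maintained x omega t.-1)|)%N%:R.

(* Main.v *)
Require Import Defs.
From HB Require Import structures.
From mathcomp Require Import all_boot all_order all_algebra.
From mathcomp Require Import all_classical all_reals all_analysis.
From mathcomp Require Import measurable_realfun ring lra zify.

Set Implicit Arguments.
Unset Strict Implicit.
Unset Printing Implicit Defensive.
Import Order.TTheory GRing.Theory Num.Theory.
Local Open Scope ring_scope.

(* Every edge e draws one threshold, once and for all, and is sampled at time t
   when the threshold lies below gamma * x_e^t, with gamma of order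
   alpha log n / delta; the maintained tree is the minimum spanning tree of the
   sampled edges.  The sample changes by about gamma * |x^t - x^(t-1)|_1 edges in
   expectation, and each of these changes the minimum spanning tree by at most
   two edges.

   Cost.  Rank the edges by cost.  If the sampled edges of rank < k have q > 1
   components, the cuts of these components contain no sampled edge of rank < k.
   Say that the sample fails if some cut S has x-weight more than eps * x(S) on
   its edges of rank < k although none of them is sampled.  If it does not fail,
   each of the q cuts has weight at least 1 - eps on the edges of rank >= k, so
   that the tree, which has at most q - 1 edges of rank >= k, has at most
   2 / (1 - eps) times the weight of x there; Abel summation over k gives the
   bound on the cost.  When the sample fails, the support of x is used instead
   of it; the same argument applies since the support misses only weight 0.

   Failure.  The edges in question are all rejected with probability at most
   exp(- gamma * eps * x(S)).  Karger's contraction argument, for all cut sizes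
   at once, bounds the sum over S of n^(- C x(S)) by a small power of n, because
   x(S) >= 1 for every S.

   Thresholds are uniform on a finite grid; the rounding error is absorbed by the
   term T / n^alpha. *)

(** * Components and greedy spanning forests *)

Section Components.
Context {V : finType}.
Implicit Types (A B : {set pedge V}) (e f : pedge V) (u v : V) (S : {set V}).

Lemma endpoints_subproof e : exists p : V * V, val e = [set p.1; p.2]%SET.
Proof. by have /cards2P[u [v [_ eE]]] := pedge_card e; exists (u, v). Qed.

(** Choice orients every edge arbitrarily, so that unordered pairs can be handled through [src] and
    [tgt]. *)
Definition endpoints e : V * V := projT1 (cid (endpoints_subproof e)).
Definition src e := (endpoints e).1.
Definition tgt e := (endpoints e).2.

Lemma val_pedge e : val e = [set src e; tgt e]%SET.
Proof. exact: (projT2 (cid (endpoints_subproof e))). Qed.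

Lemma set2_eq (T : finType) (a b u v : T) :
  [set a; b]%SET = [set u; v]%SET ->
  (a = u /\ b = v) \/ (a = v /\ b = u).
Proof.
move=> /setP ab.
have := ab v; have := ab u; have := ab b; have := ab a.
rewrite !inE !eqxx ?orbT /=.
move=> /esym/orP[]/eqP ? /esym/orP[]/eqP ? /orP[]/eqP ? /orP[]/eqP ?; subst; auto.
Qed.

Lemma adjP A u v :
  reflect (exists2 e, e \in A & (src e = u /\ tgt e = v) \/
                                (src e = v /\ tgt e = u)) (adj A u v).
Proof.
apply: (iffP existsP) => [[e /andP[eA /eqP]]|[e eA euv]].
  by rewrite val_pedge => /set2_eq; exists e.
exists e; rewrite eA val_pedge /=.
by case: euv => -[-> ->] //; rewrite finset.setUC.
Qed.

Lemma adj_sym A : symmetric (adj A).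
Proof.
by move=> u v; apply/adjP/adjP => -[e eA H]; exists e => //; case: H; auto.
Qed.

Lemma connect_adj_sym A : connect_sym (adj A).
Proof. exact/sym_connect_sym/adj_sym. Qed.

Lemma connect_edge A e : e \in A -> connect (adj A) (src e) (tgt e).
Proof. by move=> eA; apply/connect1/adjP; exists e; auto. Qed.

(** A labelling that agrees along every edge is an invariant of walks. It is applied to [comp B], to
    the identity and to [merge]. *)
Lemma eq_connected (T : Type) (r : V -> T) A u v :
  (forall e, e \in A -> r (src e) = r (tgt e)) ->
  connect (adj A) u v -> r u = r v.
Proof.
move=> rA /connectP[p + ->]; elim: p u => [//|w p IHp] u /= /andP[/adjP[e eA euw] pw].
by rewrite -(IHp _ pw); case: euw => -[<- <-]; rewrite rA.
Qed.

Definition comp A u : V := fingraph.root (adj A) u.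

Lemma compP A u v : reflect (comp A u = comp A v) (connect (adj A) u v).
Proof. exact/fingraph.rootP/connect_adj_sym. Qed.

Lemma connect_sub_edges A B u v :
  (forall e, e \in A -> connect (adj B) (src e) (tgt e)) ->
  connect (adj A) u v -> connect (adj B) u v.
Proof. by move=> AB uv; apply/compP/(eq_connected _ uv) => e /AB /compP. Qed.

Lemma sub_connect A B u v :
  A \subset B -> connect (adj A) u v -> connect (adj B) u v.
Proof. by move=> /fintype.subsetP AB; apply: connect_sub_edges => e /AB /connect_edge. Qed.

(** A partition of the vertices is encoded by a labelling [r] whose fibres are the blocks. *)
Definition classes (T : finType) (r : V -> T) : {set T} := (r @: [set: V])%SET.

Lemma leq_classes (T T' : finType) (r : V -> T) (r' : V -> T') :
  (forall u v, r u = r v -> r' u = r' v) -> (#|classes r'| <= #|classes r|)%N.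
Proof.
move=> rr'; case: (pickP V) => [v0 _|V0]; last first.
  rewrite (eq_card0 (A := classes r')) // => y; apply/negP => /imsetP[v].
  by have := V0 v.
pose g y := if [pick v | r v == y] is Some v then r' v else r' v0.
apply: leq_trans (leq_imset_card g _); apply/subset_leq_card/fintype.subsetP => y.
move=> /imsetP[v _ ->]; apply/imsetP; exists (r v); first exact: imset_f.
by rewrite /g; case: pickP => [w /eqP/rr'|/(_ v)] //; rewrite eqxx.
Qed.

Definition ncomp A := #|classes (comp A)|.

Lemma ncomp_sub A B :
  (forall u v, connect (adj A) u v -> connect (adj B) u v) -> (ncomp B <= ncomp A)%N.
Proof. by move=> AB; apply: leq_classes => u v /compP/AB/compP. Qed.

Lemma ncomp_gt0 A v : (0 < ncomp A)%N.
Proof. by apply/card_gt0P; exists (comp A v); apply: imset_f. Qed.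

Lemma ncomp0 : ncomp finset.set0 = #|V|.
Proof.
have <- : #|classes (@id V)| = #|V| by rewrite /classes card_imset ?cardsT.
apply/eqP; rewrite eqn_leq; apply/andP; split; apply: leq_classes => u v; first by move->.
by move=> /compP; apply: eq_connected => e; rewrite inE.
Qed.

Lemma ncomp_le1 A : (ncomp A <= 1)%N -> graph_connected A.
Proof. by move=> /card_le1_eqP A1 u v; apply/compP/A1; exact: imset_f. Qed.

(** Contraction of [e] in the quotient by [r]. The codomain stays the same, so contractions can be
    iterated. *)
Definition merge (T : finType) (r : V -> T) e : V -> T :=
  fun w => if r w == r (src e) then r (tgt e) else r w.

Lemma card_merge (T : finType) (r : V -> T) e :
  r (src e) != r (tgt e) -> #|classes (merge r e)|.+1 = #|classes r|.
Proof.
move=> re; rewrite [RHS](cardsD1 (r (src e))) imset_f ?inE // add1n; congr _.+1.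
apply: eq_card => y; rewrite !inE; apply/imsetP/andP => [[w _ ->]|[ye /imsetP[w _ yw]]].
  by rewrite /merge; case: ifPn => [_|->]; rewrite ?imset_f ?inE 1?eq_sym.
by exists w => //; rewrite /merge -yw (negPf ye).
Qed.

(** If [e] joins two components, the partitions given by [comp (e |: A)] and by [merge (comp A) e]
    refine each other, and [card_merge] counts the latter. *)
Lemma ncompU1 A e :
  ncomp A = (~~ connect (adj A) (src e) (tgt e) + ncomp (e |: A)%SET)%N.
Proof.
have sAe : (A \subset e |: A)%SET by apply: finset.subsetUr.
case: (boolP (connect _ _ _)) => con /=.
  apply/eqP; rewrite add0n eqn_leq; apply/andP; split; apply: ncomp_sub => u v.
    apply: connect_sub_edges => f /setU1P[->//|]; exact: connect_edge.
  exact: sub_connect.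
have ne : comp A (src e) != comp A (tgt e) by apply: contraNneq con => /compP.
rewrite add1n /ncomp -(card_merge ne); congr _.+1; apply/eqP; rewrite eqn_leq.
apply/andP; split; apply: leq_classes => u v; last first.
  have conE w w' : comp A w = comp A w' -> comp (e |: A)%SET w = comp (e |: A)%SET w'.
    by move=> /compP/(sub_connect sAe)/compP.
  have e1 : comp (e |: A)%SET (src e) = comp (e |: A)%SET (tgt e).
    by apply/compP/connect_edge; rewrite !inE eqxx.
  rewrite /merge; case: ifP => [/eqP/conE ->|_]; case: ifP => [/eqP/conE ->|_] //.
  - by move=> /conE <-.
  - by move=> /conE ->.
  - exact: conE.
move=> /compP; apply: eq_connected => f /setU1P[->|fA]; rewrite /merge.
  by rewrite eqxx; case: eqP.
by rewrite (compP _ _ _ (connect_edge fA)).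
Qed.

Lemma leq_card_ncomp A : (#|V| <= #|A| + ncomp A)%N.
Proof.
elim: {A}_.+1 {-2}A (ltnSn #|A|) => // n IHn A; rewrite ltnS => An.
have [->|[e eA]] := set_0Vmem A; first by rewrite cards0 ncomp0.
have := ncompU1 (A :\ e)%SET e; rewrite finset.setD1K // => nE.
have := IHn (A :\ e)%SET; move: An; rewrite [#|A|](cardsD1 e) eA nE => An /(_ An).
by case: (~~ _) => /=; lia.
Qed.

End Components.

(** * Kruskal's forest: size, connectivity, acyclicity, stability *)

Section LightEdges.
Context {V : finType} (rho : pedge V -> nat) (rho_inj : injective rho).
Implicit Types (A B : {set pedge V}) (e f : pedge V) (m : nat).

Definition pre A m : {set pedge V} := [set e in A | rho e < m]%N%SET.

(* Kruskal's minimum spanning forest of A for the order rho. *)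
Definition light_edges A : {set pedge V} :=
  [set e in A | ~~ connect (adj (pre A (rho e))) (src e) (tgt e)]%SET.

Lemma preP A m e : (e \in pre A m) = (e \in A) && (rho e < m)%N.
Proof. by rewrite !inE. Qed.

Lemma preS A m :
  pre A m.+1 = if [pick e in A | rho e == m] is Some e then (e |: pre A m)%SET
               else pre A m.
Proof.
apply/setP => f; rewrite preP ltnS leq_eqVlt.
case: pickP => [e /andP[eA /eqP em]|/(_ f)]; rewrite !inE; last first.
  by move=> /=; case: (f \in A) => //= ->.
rewrite -{1}em (inj_eq rho_inj) andb_orr.
by case: eqP => [->|]; rewrite ?eA ?andbF.
Qed.

Lemma preT A m : (forall e, rho e < m)%N -> pre A m = A.
Proof. by move=> ltm; apply/setP => e; rewrite preP ltm andbT. Qed.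

Lemma light_sub A : light_edges A \subset A.
Proof. by apply/fintype.subsetP => e; rewrite inE => /andP[]. Qed.

Lemma pre_subset A B m : A \subset B -> pre A m \subset pre B m.
Proof.
by move=> /fintype.subsetP AB; apply/fintype.subsetP => e; rewrite !preP => /andP[/AB -> ->].
Qed.

(** The edge of rank [m] enters the forest exactly when it joins two components of the edges of
    lower rank, so the sum is the same at every rank. The cost bound needs this count for all
    prefixes, not only for the whole of [A]. *)
Lemma card_pre_light A m : (#|pre (light_edges A) m| + ncomp (pre A m) = #|V|)%N.
Proof.
elim: m => [|m IHm].
  have pre0 B : pre B 0 = finset.set0 by apply/setP => e; rewrite !inE andbF.
  by rewrite !pre0 cards0 ncomp0.
rewrite !preS; case: (pickP (fun e => (e \in A) && (rho e == m))) => [e /andP[eA /eqP em]|Am].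
  have eN B : e \notin pre B m by rewrite preP em ltnn andbF.
  move: IHm; rewrite (ncompU1 (pre A m) e) addnA.
  case: pickP => [f /andP[fL /eqP fm]|/(_ e)].
    have fe : f = e by apply: rho_inj; rewrite fm em.
    by move: fL; rewrite {}fe inE em => /andP[_ ->] <-; rewrite cardsU1 eN /= [(1 + _)%N]addnC.
  move=> /= + nE; rewrite em eqxx andbT inE em eA /= => /negbFE con.
  by move: nE; rewrite con /= addn0.
case: pickP => [f /andP[fL fm]|//].
by have := Am f; rewrite fm (fintype.subsetP (light_sub A)).
Qed.

(** Strong induction on the rank: the endpoints of a rejected edge are already joined by edges of
    smaller rank. *)
Lemma connect_pre_light A m u v :
  connect (adj (pre (light_edges A) m)) u v = connect (adj (pre A m)) u v.
Proof.
apply/idP/idP; first exact/sub_connect/pre_subset/light_sub.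
elim/ltn_ind: m u v => m IHm u v; apply: connect_sub_edges => e.
rewrite preP => /andP[eA em].
case: (boolP (e \in light_edges A)) => [eL|].
  by apply: connect_edge; rewrite preP eL.
rewrite inE eA /= negbK => /(IHm _ em); apply: sub_connect.
by apply/fintype.subsetP => f; rewrite !preP => /andP[-> /= fe]; apply: ltn_trans em.
Qed.

Lemma rho_bounded : exists m, forall e, (rho e < m)%N.
Proof.
exists (\max_e rho e).+1 => e; rewrite ltnS; exact: leq_bigmax.
Qed.

Lemma connect_light A u v : connect (adj (light_edges A)) u v = connect (adj A) u v.
Proof.
have [m ltm] := rho_bounded.
by rewrite -(preT (light_edges A) ltm) connect_pre_light preT.
Qed.

Lemma card_light A : (#|light_edges A| + ncomp A = #|V|)%N.
Proof.
have [m ltm] := rho_bounded.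
by rewrite -[in RHS](card_pre_light A m) !preT.
Qed.

(** Otherwise dropping [e] would keep the components of [A] with fewer than [#|V| - ncomp A] edges,
    against [leq_card_ncomp]. *)
Lemma light_edge_bridge A e : e \in light_edges A ->
  ~~ connect (adj (light_edges A :\ e)%SET) (src e) (tgt e).
Proof.
move=> eL; apply/negP => con; have := leq_card_ncomp (light_edges A :\ e)%SET.
have := card_light A; rewrite (cardsD1 e (light_edges A)) eL => <-.
rewrite add1n addSnnS leq_add2l ltnNge => /negP; apply.
apply: ncomp_sub => u v; rewrite -connect_light; apply: connect_sub_edges => f fL.
have [->//|fe] := eqVneq f e.
by apply: connect_edge; rewrite finset.in_setD1 fe.
Qed.

(** On a cycle x, y, z, ... the rest of the cycle would bypass the edge between x and y, which is a
    bridge. *)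
Lemma light_acyclic A : graph_acyclic (light_edges A).
Proof.
set F := light_edges A.
move=> [//|x [//|y [//|z q]]] /andP[] /=; rewrite rcons_path => /and4P[xy yz zq lx].
rewrite !inE !negb_or => /andP[/and3P[nxy nxz xq] /and3P[/andP[nyz yq] _ _]].
case/adjP: xy => e eF exy; have := light_edge_bridge eF; apply: contraTT => _; rewrite negbK.
suff con : connect (adj (F :\ e)%SET) y x.
  by case: exy => -[-> ->] //; rewrite connect_adj_sym.
(* A step with an endpoint outside {x, y} cannot use [e]. *)
have adjD u v : adj F u v -> (u != x) && (u != y) || (v != x) && (v != y) -> adj (F :\ e)%SET u v.
  case/adjP => f fF fuv H; apply/adjP; exists f => //; rewrite finset.in_setD1 fF andbT.
  apply: contraTneq H => fe; move: fuv exy; rewrite fe.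
  by case=> -[-> ->] [] [-> ->]; rewrite !eqxx ?andbF.
apply: (@connect_trans _ _ z).
  by apply/connect1/adjD => //; rewrite ![z == _]eq_sym nxz nyz orbT.
apply: (@connect_trans _ _ (last z q)); last first.
  apply/connect1/adjD => //; apply/orP; left.
  have := mem_last z q; rewrite inE => /predU1P[->|lq].
    by rewrite ![z == _]eq_sym nxz nyz.
  by apply/andP; split; [apply: contraNneq xq|apply: contraNneq yq] => <-.
apply/connectP; exists q => //.
elim: q z {nxz nyz yz lx} zq xq yq => //= w q IHq z /andP[zw wq].
rewrite !inE !negb_or => /andP[xw xq] /andP[yw yq].
rewrite IHq // andbT; apply: adjD => //.
by rewrite ![w == _]eq_sym xw yw orbT.
Qed.

(** An edge of [A] that is light in [B] is light in [A], which offers fewer detours; hence the edges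
    gained lie in [B :\: A]. The forest of [B] is at least as large as that of [A], so no more edges
    are lost than gained. *)
Lemma light_stable_sub A B : A \subset B ->
  (#|symdiff (light_edges B) (light_edges A)| <= 2 * #|B :\: A|)%N.
Proof.
move=> AB; have LBA : (light_edges B :\: light_edges A \subset B :\: A)%SET.
  apply/fintype.subsetP => e; rewrite !inE => /andP[+ /andP[eB /negP eL]].
  rewrite eB andbT; apply: contra => eA; rewrite eA /=; apply/negP => con; apply: eL.
  by apply: sub_connect con; apply: pre_subset.
have le : (#|light_edges A| <= #|light_edges B|)%N.
  have := card_light A; rewrite -(card_light B).
  have : (ncomp B <= ncomp A)%N by apply: ncomp_sub => u v; apply: sub_connect.
  lia.
have := subset_leq_card LBA; rewrite /symdiff cardsU; move: le.
rewrite -(cardsID (light_edges B) (light_edges A)).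
rewrite -(cardsID (light_edges A) (light_edges B)) finset.setIC; lia.
Qed.

Lemma card_symdiff_triangle A B C :
  (#|symdiff A C| <= #|symdiff A B| + #|symdiff B C|)%N.
Proof.
rewrite -cardsUI; apply: leq_trans (leq_addr _ _); apply/subset_leq_card/fintype.subsetP => e.
by rewrite !inE; case: (e \in A); case: (e \in B); case: (e \in C).
Qed.

Lemma symdiffC A B : symdiff A B = symdiff B A.
Proof. by rewrite /symdiff finset.setUC. Qed.

Lemma light_stable A B :
  (#|symdiff (light_edges A) (light_edges B)| <= 2 * #|symdiff A B|)%N.
Proof.
apply: leq_trans (card_symdiff_triangle _ (light_edges (A :|: B)%SET) _) _.
have := light_stable_sub (finset.subsetUl A B).
have := light_stable_sub (finset.subsetUr A B).
rewrite [symdiff _ (light_edges A)]symdiffC !finset.setDUl !finset.setDv finset.set0U finset.setU0.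
rewrite /symdiff (cardsU (A :\: B)%SET).
have -> : ((A :\: B) :&: (B :\: A) = finset.set0)%SET.
  by apply/setP => e; rewrite !inE; case: (e \in A); rewrite ?andbF.
rewrite cards0; lia.
Qed.

Lemma light_card_le A : (#|light_edges A| <= #|V|)%N.
Proof. by rewrite -(card_light A) leq_addr. Qed.

End LightEdges.

(** * Cost of the greedy forest *)

Section CutWeights.
Context {R : realType} {V : finType}.
Implicit Types (S : {set V}) (e : pedge V) (x y : pedge V -> R).

Definition crosses S e := (src e \in S) != (tgt e \in S).

Definition nontrivial S := (S != finset.set0) && (S != [set: V]%SET).

Definition cut_weight x S : R := \sum_(e | crosses S e) x e.

Lemma in_cut (E : {set pedge V}) S e : (e \in Defs.cut E S) = (e \in E) && crosses S e.
Proof.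
rewrite /Defs.cut /crosses inE; congr (_ && _); apply/existsP/idP => [[u]|].
  move=> /andP[uS /existsP[v]]; rewrite inE => /andP[vS /eqP].
  rewrite val_pedge => /set2_eq.
  by case=> -[-> ->]; rewrite uS (negPf vS).
case srcS : (src e \in S); case tgtS : (tgt e \in S) => // _.
  exists (src e); rewrite srcS; apply/existsP; exists (tgt e).
  by rewrite inE tgtS val_pedge /=.
exists (tgt e); rewrite tgtS; apply/existsP; exists (src e).
by rewrite inE srcS val_pedge /= finset.setUC.
Qed.

(** An edge between two classes crosses exactly the cuts of these two classes; an edge inside a
    class crosses none. *)
Lemma sum_class_cuts (T : finType) (r : V -> T) y :
  \sum_(i in classes r) cut_weight y [set v | r v == i]%SET =
  2 * \sum_(e | r (src e) != r (tgt e)) y e.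
Proof.
rewrite /cut_weight; under eq_bigr do rewrite big_mkcond /=.
rewrite exchange_big /= [in RHS]big_mkcond mulr_sumr; apply: eq_bigr => e _.
rewrite -big_mkcondr /= sumr_const.
case: (eqVneq (r (src e)) (r (tgt e))) => [re|re] /=.
  rewrite mulr0 eq_card0 // => i.
  by rewrite unfold_in /crosses !inE re eqxx andbF.
rewrite [RHS]mulr_natl; congr (_ *+ _).
rewrite -[RHS](_ : #|[set r (src e); r (tgt e)]%SET| = _); last by rewrite cards2 re.
apply: eq_card => i; rewrite !inE unfold_in /crosses !inE ![i == _]eq_sym.
have [<-|] := eqVneq (r (src e)) i; first by rewrite imset_f ?inE // [r (tgt e) == _]eq_sym (negPf re).
have [<-|] := eqVneq (r (tgt e)) i; first by rewrite imset_f ?inE.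
by rewrite andbF.
Qed.

Lemma class_nontrivial (T : finType) (r : V -> T) i :
  (1 < #|classes r|)%N -> i \in classes r -> nontrivial [set v | r v == i]%SET.
Proof.
move=> r1 /imsetP[v _ ->]; apply/andP; split.
  by apply/set0Pn; exists v; rewrite inE.
apply: contraTneq r1 => rT; rewrite -leqNgt; apply/card_le1_eqP.
have rv w : r w = r v by apply/eqP; have := finset.in_setT w; rewrite -rT inE.
by move=> _ _ /imsetP[? _ ->] /imsetP[? _ ->]; rewrite !rv.
Qed.

Lemma classes_cut_bound (T : finType) (r : V -> T) y b :
  (1 < #|classes r|)%N ->
  (forall i, i \in classes r -> b <= cut_weight y [set v | r v == i]%SET) ->
  #|classes r|%:R * b <= 2 * \sum_(e | r (src e) != r (tgt e)) y e.
Proof.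
by move=> r1 yb; rewrite -sum_class_cuts mulr_natl -sumr_const ler_sum.
Qed.

End CutWeights.

Section TreeCost.
Context {R : realType} {V : finType} (rho : pedge V -> nat) (rho_inj : injective rho).
Implicit Types (S : {set V}) (e : pedge V) (x g c : pedge V -> R).

(* Abel summation along rho. *)
Lemma sumr_monotone_ge0 c g :
  (forall e, 0 <= c e) -> (forall e f, (rho e <= rho f)%N -> c e <= c f) ->
  (forall m, 0 <= \sum_(e | (m <= rho e)%N) g e) ->
  0 <= \sum_e c e * g e.
Proof.
move=> c0 cmono g0; have [N ltN] := rho_bounded rho.
(* Downward induction on the rank [m]. The free lower bound [d] lets the cost of the current edge
   take its place in the induction hypothesis; the lemma is the case where [m] and [d] are 0. *)
suff main k m d : (m + k = N)%N -> (forall e, (m <= rho e)%N -> d <= c e) ->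
    d * (\sum_(e | (m <= rho e)%N) g e) <= \sum_(e | (m <= rho e)%N) c e * g e.
  have := main N 0%N 0; rewrite mul0r => H; exact: H.
elim: k m d => [|k IHk] m d mN dc.
  by rewrite !big_pred0 ?mulr0 // => e; apply/negbTE; rewrite -ltnNge; have := ltN e; lia.
have geE e : (m <= rho e)%N = (rho e == m) || (m < rho e)%N by rewrite leq_eqVlt eq_sym.
case: (pickP (fun e => rho e == m)) => [e /eqP em|em]; last first.
  have emE e : (m <= rho e)%N = (m < rho e)%N by rewrite geE em.
  rewrite !(eq_bigl _ _ emE).
  by apply: IHk => [|e em']; [lia|apply: dc; lia].
have ltE f : (m <= rho f)%N && (f != e) = (m < rho f)%N.
  by rewrite geE -em (inj_eq rho_inj); case: eqVneq => [->|]; rewrite ?ltnn ?andbT.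
have splitE h : \sum_(f | (m <= rho f)%N) h f = h e + \sum_(f | (m < rho f)%N) h f :> R.
  by rewrite (bigD1 e) ?em //= (eq_bigl _ _ ltE).
have := g0 m; rewrite !splitE => gm.
have IH : c e * (\sum_(f | (m < rho f)%N) g f) <= \sum_(f | (m < rho f)%N) c f * g f.
  by apply: IHk => [|f ef]; [lia|apply: cmono; lia].
have : d * (g e + \sum_(f | (m < rho f)%N) g f) <= c e * (g e + \sum_(f | (m < rho f)%N) g f).
  by rewrite ler_wpM2r // dc // em.
by move=> /le_trans; apply; rewrite mulrDr lerD2l.
Qed.

Variables (x : pedge V -> R) (eps : R) (A : {set pedge V}).
Hypotheses (x_ge0 : forall e, 0 <= x e) (eps_lt1 : eps < 1).
Hypothesis x_cut : forall S, nontrivial S -> 1 <= cut_weight x S.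
(** Contrapositively, [A] meets every set of low-rank edges that carries more than an [eps] share of
    its cut. The cost bound uses nothing else about the sample. *)
Hypothesis hit : forall m S, nontrivial S ->
  (forall e, crosses S e -> (rho e < m)%N -> e \notin A) ->
  \sum_(e | crosses S e && (rho e < m)%N) x e <= eps * cut_weight x S.

(** The cut around a component of [pre rho A m] has no edge of [A] of rank below [m], so [hit]
    leaves weight at least [1 - eps] to the ranks from [m] on. Each edge lies in at most two of
    these cuts. *)
Lemma ncomp_tail m : (1 < ncomp (pre rho A m))%N ->
  (ncomp (pre rho A m))%:R * (1 - eps) <= 2 * \sum_(e | (m <= rho e)%N) x e.
Proof.
move=> n1; set r := comp (pre rho A m).
pose y e := if (m <= rho e)%N then x e else 0.
have y0 e : 0 <= y e by rewrite /y; case: ifP.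
have := @classes_cut_bound R V V r y (1 - eps) n1.
set X := \sum_(e | _ != _) y e; have XT : X <= \sum_(e | (m <= rho e)%N) x e.
  rewrite [leRHS]big_mkcond /X [leLHS]big_mkcond /=; apply: ler_sum => e _.
  by case: ifP; rewrite /= ?y0.
move=> H; apply: le_trans (H _) _; last by rewrite ler_pM2l.
move=> i ir; have Snt := class_nontrivial n1 ir; set S := [set v | _]%SET in Snt *.
have := @hit m S Snt; have := x_cut Snt.
have -> : cut_weight x S = \sum_(e | crosses S e && (rho e < m)%N) x e + cut_weight y S.
  rewrite /cut_weight (bigID (fun e => rho e < m)%N) /=; congr (_ + _).
  rewrite big_mkcondr /=; apply: eq_bigr => e _; rewrite /y -leqNgt.
  by [].
set z := \sum_(e | _ && _) _ => S1 Seps.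
have {Seps} : z <= eps * (z + cut_weight y S).
  apply: Seps => e eS em; apply: contraTN eS => eA; rewrite /crosses negbK !inE.
  suff -> : comp (pre rho A m) (src e) = comp (pre rho A m) (tgt e) by [].
  by apply/compP/connect_edge; rewrite preP eA.
set w := cut_weight y S in S1 *; move=> Seps.
(* The cut weight [z + w] is at least 1 and [z] is at most its [eps] share, so
   [w >= (1 - eps) * (z + w) >= 1 - eps]. *)
have P : 0 <= (1 - eps) * (z + w - 1)
  by rewrite mulr_ge0 ?subr_ge0 // ltW.
nra.
Qed.

Lemma hit_connected : graph_connected A.
Proof.
have [N ltN] := rho_bounded rho.
apply: ncomp_le1; rewrite leqNgt; apply/negP; rewrite -(preT A ltN) => n1.
have := ncomp_tail n1; rewrite [X in 2 * X]big_pred0 => [|e]; last first.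
  by apply/negbTE; rewrite -ltnNge.
by rewrite mulr0 leNgt mulr_gt0 ?subr_gt0 // ltr0n ltnW.
Qed.

(** By [card_pre_light] the forest has [ncomp (pre rho A m) - ncomp A] edges of rank at least [m],
    and [ncomp_tail] bounds the first term. *)
Lemma light_tail m :
  (#|[set e in light_edges rho A | (m <= rho e)%N]%SET|)%:R * (1 - eps) <=
  2 * \sum_(e | (m <= rho e)%N) x e.
Proof.
set L := light_edges rho A.
have Lm : (#|[set e in L | (m <= rho e)%N]%SET| + ncomp A = ncomp (pre rho A m))%N.
  apply/eqP; rewrite -(eqn_add2l #|pre rho L m|) card_pre_light // addnA -(card_light rho_inj A).
  rewrite eqn_add2r -/L -(cardsID [set e | rho e < m]%N%SET L).
  have -> : pre rho L m = (L :&: [set e | rho e < m]%N)%SET.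
    by apply/setP => e; rewrite preP !inE.
  have -> // : [set e in L | (m <= rho e)%N]%SET = (L :\: [set e | rho e < m]%N)%SET.
  by apply/setP => e; rewrite !inE leqNgt andbC.
have [n1|] := ltnP 1 (ncomp (pre rho A m)).
  apply: le_trans (ncomp_tail n1); rewrite ler_pM2r ?subr_gt0 // ler_nat -Lm; exact: leq_addr.
have xm : 0 <= 2 * \sum_(e | (m <= rho e)%N) x e by rewrite mulr_ge0 ?sumr_ge0.
(* With at most one component below rank [m] no such edge is left, because [ncomp A] is positive
   once there is a vertex; without vertices there are no edges. *)
case: (pickP V) => [v _|V0] n1.
  have -> : #|[set e in L | (m <= rho e)%N]%SET| = 0%N by have := ncomp_gt0 A v; lia.
  by rewrite mul0r.
rewrite (eq_card0 (A := [set e in L | _]%SET)) ?mul0r // => e.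
by have := V0 (src e).
Qed.

Lemma light_cost c :
  (forall e, 0 <= c e) -> (forall e f, (rho e <= rho f)%N -> c e <= c f) ->
  cost c (light_edges rho A) * (1 - eps) <= 2 * \sum_e c e * x e.
Proof.
move=> c0 cmono; set L := light_edges rho A.
have := @sumr_monotone_ge0 c (fun e => 2 * x e - (e \in L)%:R * (1 - eps)) c0 cmono.
have -> : \sum_e c e * (2 * x e - (e \in L)%:R * (1 - eps)) =
    2 * \sum_e c e * x e - cost c L * (1 - eps).
  rewrite /cost [X in _ - X * _]big_mkcond mulr_sumr mulr_suml -sumrB; apply: eq_bigr => e _ /=.
  by case: (e \in L) => /=; ring.
move=> H; rewrite -subr_ge0; apply: H => m.
rewrite sumrB -mulr_sumr -mulr_suml subr_ge0; apply: le_trans (light_tail m).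
rewrite -natr_sum -sum1dep_card big_mkcondl /= -/L.
by rewrite (eq_bigr (fun e => if e \in L then 1 else 0)%N) // => e _; case: (e \in L).
Qed.

End TreeCost.

(** * Counting cuts by contraction *)

Section CutCounting.
Context {R : realType} {V : finType}.
Implicit Types (S : {set V}) (e : pedge V) (r : V -> V).

(** [S] is a union of blocks of [r]: its cut survives the contraction. *)
Definition saturated r S := [forall u, forall v, (r u == r v) ==> ((u \in S) == (v \in S))].

Definition saturated_cuts r : {set {set V}} := [set S | saturated r S && nontrivial S]%SET.

Lemma saturatedP r S :
  reflect (forall u v, r u = r v -> (u \in S) = (v \in S)) (saturated r S).
Proof.
apply: (iffP forallP) => [H u v /eqP ruv|H u]; last first.
  by apply/forallP => v; apply/implyP => /eqP/H ->.
by have /forallP/(_ v)/implyP/(_ ruv)/eqP := H u.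
Qed.

Lemma saturated_merge r S e :
  saturated r S -> ~~ crosses S e -> saturated (merge r e) S.
Proof.
rewrite negbK => /saturatedP rS /eqP eS; apply/saturatedP => u v; rewrite /merge.
case: eqP => [/rS ->|_]; case: eqP => [/rS ->|_] //; last exact: rS.
  by move=> /rS <-; rewrite eS.
by move=> /rS ->; rewrite eS.
Qed.

Lemma card_saturated_cuts r : (#|saturated_cuts r| <= 2 ^ #|classes r|)%N.
Proof.
rewrite -card_powerset.
have := leq_imset_card (fun C : {set V} => r @^-1: C)%SET (mem (powerset (classes r))).
apply: leq_trans; apply/subset_leq_card/fintype.subsetP => S; rewrite inE => /andP[/saturatedP rS _].
apply/imsetP; exists (r @: S)%SET; first by rewrite powersetE; apply: imsetS; apply: finset.subsetT.
apply/setP => u; rewrite inE; apply/idP/imsetP => [uS|[v vS /rS ->//]].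
by exists u.
Qed.

Variable x : pedge V -> R.
Hypotheses (x_ge0 : forall e, 0 <= x e)
  (x_cut : forall S, nontrivial S -> 1 <= cut_weight x S).

Definition between r := \sum_(e | r (src e) != r (tgt e)) x e.

Lemma saturated_crosses r S e : saturated r S -> crosses S e -> r (src e) != r (tgt e).
Proof. by move=> /saturatedP rS; apply: contraNneq => /rS ->. Qed.

Lemma cut_weight_between r S : saturated r S ->
  between r - cut_weight x S = \sum_(e | (r (src e) != r (tgt e)) && ~~ crosses S e) x e.
Proof.
move=> rS; rewrite /between (bigID (crosses S)) /= addrC.
have -> : \sum_(e | (r (src e) != r (tgt e)) && crosses S e) x e = cut_weight x S.
  apply: eq_bigl => e; apply: andb_idl; exact: saturated_crosses.
by rewrite addrK.
Qed.

Lemma between_ge r : (1 < #|classes r|)%N -> #|classes r|%:R <= 2 * between r.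
Proof.
move=> r1; rewrite -[leLHS]mulr1; apply: classes_cut_bound => // i ir.
exact/x_cut/class_nontrivial.
Qed.

(* One step of the random contraction algorithm: an edge joining two classes of
   r is merged with probability proportional to its weight. *)
Lemma contraction_step r (phi : {set V} -> R) B :
  0 < between r -> (forall S, 0 <= phi S) ->
  (forall e, r (src e) != r (tgt e) ->
     \sum_(S in saturated_cuts (merge r e)) phi S <= B) ->
  \sum_(S in saturated_cuts r) (1 - cut_weight x S / between r) * phi S <= B.
Proof.
move=> X0 phi0 phiB; rewrite -(ler_pM2l X0) mulr_sumr.
(* The difference [between r - cut_weight x S] is the weight of the edges whose contraction
   preserves [S]; the two sums are then exchanged. *)
have -> : \sum_(S in saturated_cuts r) between r * ((1 - cut_weight x S / between r) * phi S) =
    \sum_(e | r (src e) != r (tgt e)) x e *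
       (\sum_(S in saturated_cuts r | ~~ crosses S e) phi S).
  under [RHS]eq_bigr do rewrite mulr_sumr.
  rewrite (exchange_big_dep (mem (saturated_cuts r))) /=; last by move=> ? ? _ /andP[].
  apply: eq_bigr => S /=; rewrite inE => /andP[rS ntS].
  rewrite mulrA mulrBr mulr1 mulrCA divff ?gt_eqF // mulr1 cut_weight_between //.
  by rewrite mulr_suml; apply: eq_bigl => e /=; rewrite rS ntS.
rewrite /between mulr_suml; apply: ler_sum => e re; apply: ler_wpM2l => //.
apply: le_trans (phiB _ re); rewrite big_mkcond [leRHS]big_mkcond /=.
apply: ler_sum => S _; case: ifP => [/andP[]|_]; last by case: ifP.
by rewrite !inE => /andP[rS ->] /(saturated_merge rS) ->.
Qed.

(** The term [4 * ln k] is tuned so that passing from [k] to [k - 1] classes pays for the survival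
    probability [1 - a / X]: the exponent gains at least [4 * a / k >= 2 * a / X]. *)
Lemma contraction_weight (a s X : R) k : (2 <= k)%N ->
  k%:R <= 2 * X -> 0 <= a -> 2 * a <= X ->
  expR (- (a * (s + 4 * ln k%:R))) <=
  (1 - a / X) * expR (- (a * (s + 4 * ln k.-1%:R))).
Proof.
case: k => [|[//|k]] // _ kX a0 aX; set j := k.+1%:R : R; set l := k.+2%:R : R in kX *.
have j0 : 0 < j by rewrite ltr0n.
have lj : l = j + 1 by rewrite /l -natr1.
have l0 : 0 < l by rewrite ltr0n.
have X0 : 0 < X by nra.
have lnlj : l^-1 <= ln l - ln j.
  rewrite -lerN2 opprB -ln_div ?posrE //.
  have -> : j / l = 1 + - l^-1 by rewrite lj; field; lra.
  apply: le_ln1Dx; rewrite ltrN2 invf_lt1 // lj; lra.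
set u := a / X.
have u0 : 0 <= u by rewrite divr_ge0 // ltW.
have u1 : u <= 1 / 2 by rewrite ler_pdivrMr //; lra.
have ul : u <= 2 * (a / l).
  rewrite mulrA ler_pdivlMr // /u mulrAC ler_pdivrMr //.
  have := ler_wpM2l a0 kX; lra.
have -> : - (a * (s + 4 * ln l)) = - (4 * (a * (ln l - ln j))) + - (a * (s + 4 * ln j)) by ring.
rewrite expRD ler_pM2r ?expR_gt0 //.
apply: (@le_trans _ _ (expR (- (2 * u)))).
  rewrite ler_expR lerN2; apply: le_trans (_ : 4 * (a / l) <= _).
    by move: (a / l) ul => p; clearbody u; lra.
  by rewrite ler_pM2l // ler_wpM2l.
rewrite expRN -[leLHS]mul1r ler_pdivrMr ?expR_gt0 //.
(* For [0 <= u <= 1 / 2] one has [(1 - u) * (1 + 2 * u) >= 1]. *)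
have := expR_ge1Dx (2 * u); nra.
Qed.

(** Induction on the number [k] of classes. Cuts of weight at most half of [between r] are passed to
    [k - 1] classes by a contraction step. The others weigh more than [k / 4] and number at most
    [2 ^ k], so they contribute at most [th ^+ k <= th ^+ 2]. *)
Lemma sum_saturated_cuts s r : 2 * expR (- (s / 4)) <= 1 ->
  \sum_(S in saturated_cuts r)
    expR (- (cut_weight x S * (s + 4 * ln #|classes r|%:R))) <=
  #|classes r|%:R * (2 * expR (- (s / 4))) ^+ 2.
Proof.
move=> th1; set th := 2 * expR (- (s / 4)) in th1 *.
have th0 : 0 <= th by rewrite mulr_ge0 ?expR_ge0.
have s0 : 0 <= s.
  rewrite leNgt; apply/negP => s0; suff : 1 < expR (- (s / 4)) by move: th1; rewrite /th; lra.
  by rewrite expR_gt1; lra.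
have [n] := ubnP #|classes r|; elim: n r => // n IHn r; rewrite ltnS => rn.
have [r1|r1] := leqP #|classes r| 1.
  rewrite big_pred0 ?mulr_ge0 ?exprn_ge0 // => S; apply/negbTE.
  rewrite inE negb_and -implybE; apply/implyP => /saturatedP rS.
  have S1 u v : (u \in S) = (v \in S).
    by apply: rS; move/card_le1_eqP: r1; apply; apply: imset_f.
  rewrite negb_and !negbK; have [->|[v vS]] := set_0Vmem S; first by rewrite eqxx.
  by apply/orP; right; apply/eqP/setP => u; rewrite inE (S1 u v).
set k := #|classes r| in rn r1 *.
have kX := between_ge r1; rewrite -/k in kX.
have X0 : 0 < between r by have : 0 < k%:R :> R by [rewrite ltr0n; lia]; lra.
have kE : k%:R = k.-1%:R + 1 :> R by rewrite natr1 prednK //; lia.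
have -> : k%:R * th ^+ 2 = k.-1%:R * th ^+ 2 + th ^+ 2 by rewrite kE mulrDl mul1r.
rewrite (bigID (fun S => 2 * cut_weight x S <= between r)) /=.
apply: lerD.
  pose phi S := expR (- (cut_weight x S * (s + 4 * ln k.-1%:R))).
  apply: (@le_trans _ _ (\sum_(S in saturated_cuts r) (1 - cut_weight x S / between r) * phi S)).
    rewrite [leRHS](bigID (fun S => 2 * cut_weight x S <= between r)) /=.
    rewrite -[leLHS]addr0; apply: lerD.
      apply: ler_sum => S /andP[_ SX]; apply: contraction_weight => //.
      exact: sumr_ge0.
    apply: sumr_ge0 => S /andP[+ _]; rewrite inE => /andP[rS _].
    rewrite mulr_ge0 ?expR_ge0 // subr_ge0 ler_pdivrMr // mul1r -subr_ge0.
    by rewrite cut_weight_between // sumr_ge0.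
  apply: contraction_step => // [S|e re]; first exact: expR_ge0.
  have ck : #|classes (merge r e)| = k.-1 by rewrite /k -(card_merge re).
  by have := IHn (merge r e); rewrite ck; apply; lia.
have small S : ~~ (2 * cut_weight x S <= between r) ->
    expR (- (cut_weight x S * (s + 4 * ln k%:R))) <= expR (- (s / 4)) ^+ k.
  rewrite -ltNge => SX; rewrite -expRM_natl ler_expR mulrN lerN2.
  have lnk : 0 <= ln k%:R :> R by rewrite ln_ge0 // ler1n; lia.
  have : 0 <= cut_weight x S by exact: sumr_ge0.
  nra.
apply: (@le_trans _ _ (\sum_(S in saturated_cuts r) expR (- (s / 4)) ^+ k)).
  rewrite big_mkcondr /=; apply: ler_sum => S _; case: ifP => [/small//|_].
  by rewrite exprn_ge0 ?expR_ge0.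
rewrite sumr_const -[leLHS]mulr_natl; apply: (@le_trans _ _ (th ^+ k)).
  rewrite /th exprMn ler_wpM2r ?exprn_ge0 ?expR_ge0 // -natrX ler_nat.
  exact: card_saturated_cuts.
exact: ler_wiXn2l.
Qed.

Lemma sum_nontrivial_cuts s : 2 * expR (- (s / 4)) <= 1 ->
  \sum_(S | nontrivial S) expR (- (cut_weight x S * (s + 4 * ln #|V|%:R))) <=
  #|V|%:R * (2 * expR (- (s / 4))) ^+ 2.
Proof.
move=> /sum_saturated_cuts - /(_ id).
have -> : #|classes (@id V)| = #|V| by rewrite /classes card_imset ?cardsT.
apply: le_trans; rewrite le_eqVlt; apply/orP; left; apply/eqP; apply: eq_bigl => S.
rewrite inE; suff -> : saturated id S by [].
by apply/saturatedP => u v ->.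
Qed.

End CutCounting.

(** * Random thresholds *)

Section Average.
Context {R : realType} {T : finType}.
Implicit Types (f g : T -> R).

Definition average f : R := (\sum_w f w) / #|T|%:R.

Lemma ler_average f g : (forall w, f w <= g w) -> average f <= average g.
Proof. by move=> fg; rewrite ler_wpM2r ?invr_ge0 ?ler0n ?ler_sum. Qed.

Lemma average_sum (I : Type) (s : seq I) (P : pred I) (F : I -> T -> R) :
  average (fun w => \sum_(i <- s | P i) F i w) = \sum_(i <- s | P i) average (F i).
Proof. by rewrite /average exchange_big mulr_suml. Qed.

Lemma averageD f g : average (fun w => f w + g w) = average f + average g.
Proof. by rewrite /average big_split mulrDl. Qed.

Lemma averageZ a f : average (fun w => a * f w) = a * average f.
Proof. by rewrite /average -mulr_sumr mulrA. Qed.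

End Average.

Section Thresholds.
Context {R : realType} (M : nat).
Implicit Types (g h : R).

Lemma sum_ord_lt a : (\sum_(i < M) (i < a) = minn M a)%N.
Proof.
elim: M => [|m IHm]; first by rewrite big_ord0 min0n.
by rewrite big_ord_recr /= IHm; case: ltnP; lia.
Qed.

(** The threshold [i / M] lies below [g], written without division. *)
Definition kept g (i : 'I_M) : bool := i%:R < M%:R * g.

Definition kept_count g : nat := (\sum_(i < M) kept g i)%N.

Lemma kept_mono g h i : g <= h -> kept g i -> kept h i.
Proof. by move=> gh /lt_le_trans; apply; rewrite ler_wpM2l. Qed.

(** The witness is the ceiling of [M * g]: the integers strictly below a real are those below its
    ceiling. *)
Lemma kept_countE g : 0 <= g ->
  exists a : nat, [/\ M%:R * g <= a%:R, a%:R < M%:R * g + 1 & kept_count g = minn M a].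
Proof.
move=> g0; have z0 : 0 <= M%:R * g by rewrite mulr_ge0.
have c0 : 0 <= Num.ceil (M%:R * g) by rewrite ceil_ge0; lra.
exists `|Num.ceil (M%:R * g)|%N; have := ceil_itv (M%:R * g).
have cE : (`|Num.ceil (M%:R * g)|%N)%:R = (Num.ceil (M%:R * g))%:~R :> R.
  by rewrite -[in RHS](gez0_abs c0).
rewrite intrB cE => /andP[? ?]; split; [by []|lra|].
rewrite /kept_count -sum_ord_lt; apply: eq_bigr => i _; congr nat_of_bool.
by rewrite /kept (pmulrn _ i) -ceil_gt_int -{1}(gez0_abs c0) ltz_nat.
Qed.

Lemma kept_count_diff g h : 0 <= g -> g <= h ->
  (kept_count h)%:R - (kept_count g)%:R <= M%:R * (h - g) + 1.
Proof.
move=> g0 gh; have [a [ga _ ->]] := kept_countE g0.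
have [b [_ bh ->]] := kept_countE (le_trans g0 gh).
have : 0 <= M%:R * (h - g) by rewrite mulr_ge0 // subr_ge0.
have : (minn M b)%:R <= b%:R :> R by rewrite ler_nat geq_minr.
have : (minn M b)%:R <= M%:R :> R by rewrite ler_nat geq_minl.
by rewrite /minn; case: ifP; case: ifP; rewrite mulrBr; lra.
Qed.

(** Rounding up favours acceptance, so [1 - g <= expR (- g)] carries over to the grid without an
    error term. *)
Lemma rejected_count g : 0 <= g ->
  M%:R - (kept_count g)%:R <= M%:R * expR (- g).
Proof.
move=> g0; have [a [ga _ ->]] := kept_countE g0.
have [_|aM] := leqP M a; first by rewrite subrr mulr_ge0 ?expR_ge0.
have := ler_wpM2l (ler0n R M) (expR_ge1Dx (- g)); rewrite mulrDr mulr1 mulrN; lra.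
Qed.

End Thresholds.

Section Sampling.
Context {R : realType} {V : finType} (m : nat).
Local Notation M := m.+1.
Local Notation Omega := {ffun pedge V -> 'I_M}.
Implicit Types (e : pedge V) (g h : pedge V -> R) (w : Omega) (D : pred (pedge V)).

(** Independence of the thresholds, as distributivity of the product over the sums. *)
Lemma average_prod (F : pedge V -> 'I_M -> R) :
  average (fun w : Omega => \prod_e F e (w e)) = \prod_e average (F e).
Proof.
rewrite /average prodf_div -bigA_distr_bigA /=; congr (_ / _).
by rewrite card_ffun prodr_const natrX.
Qed.

Lemma average_coord e (f : 'I_M -> R) :
  average (fun w : Omega => f (w e)) = average f.
Proof.
have := average_prod (fun e' i => if e' == e then f i else 1).
rewrite (bigD1 e) //= eqxx [X in _ * X]big1 ?mulr1 => [<-|e' /negPf e'e].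
  congr (_ / _); apply: eq_bigr => w _; rewrite (bigD1 e) //= eqxx big1 ?mulr1 // => e' /negPf -> //.
by rewrite /average e'e sumr_const divff // card_ord pnatr_eq0.
Qed.

Definition sample g w : {set pedge V} := [set e | kept (g e) (w e)]%SET.

Lemma average_rejected D g : (forall e, 0 <= g e) ->
  average (fun w => [forall e, D e ==> (e \notin sample g w)]%:R) <=
  expR (- \sum_(e | D e) g e).
Proof.
move=> g0; have -> : (fun w => [forall e, D e ==> (e \notin sample g w)]%:R) =
    (fun w => \prod_e (D e ==> ~~ kept (g e) (w e))%:R) :> (Omega -> R).
  apply/funext => w; case: forallP => [H|/forallP/forallPn[e]].
    by rewrite big1 // => e _; have := H e; rewrite inE => ->.
  by rewrite inE (bigD1 e) //= => /negPf ->; rewrite mul0r.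
rewrite (average_prod (fun e i => (D e ==> ~~ kept (g e) i)%:R)).
rewrite -sumrN expR_sum big_mkcond [leRHS]big_mkcond /=; apply: ler_prod => e _.
rewrite /average mulr_ge0 ?invr_ge0 ?ler0n ?sumr_ge0 //=.
rewrite card_ord ler_pdivrMr ?ltr0n //; case: ifP => De /=; last first.
  by rewrite sumr_const card_ord mul1r.
rewrite mulrC; apply: le_trans (rejected_count _ (g0 e)).
rewrite /kept_count natr_sum -[X in X%:R - _](card_ord M) -sumr_const -sumrB.
by apply: ler_sum => i _; case: (kept _ i); rewrite /= ?subrr ?subr0.
Qed.

(** Both samples share the thresholds, so they differ at [e] only if its threshold falls between
    [g e] and [h e]; the summand [M^-1] is the rounding error of the grid. *)
Lemma average_sample_diff g h : (forall e, 0 <= g e) -> (forall e, 0 <= h e) ->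
  average (fun w => #|symdiff (sample g w) (sample h w)|%:R) <=
  \sum_e (`|g e - h e| + M%:R^-1).
Proof.
move=> g0 h0.
have -> : (fun w => #|symdiff (sample g w) (sample h w)|%:R) =
    (fun w => \sum_e (kept (g e) (w e) != kept (h e) (w e))%:R) :> (Omega -> R).
  apply/funext => w; rewrite -sum1_card natr_sum big_mkcond /=; apply: eq_bigr => e _.
  by rewrite !inE; case: (kept _ _); case: (kept _ _).
rewrite average_sum; apply: ler_sum => e _.
rewrite (average_coord e (fun i => (kept (g e) i != kept (h e) i)%:R)).
rewrite /average card_ord ler_pdivrMr ?ltr0n // mulrDl mulVf ?pnatr_eq0 //.
wlog gh : g h g0 h0 / g e <= h e => [H|].
  have [/H|/ltW hg] := leP (g e) (h e); first exact.
  by under eq_bigr do rewrite eq_sym; rewrite distrC; apply: H.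
rewrite distrC ger0_norm ?subr_ge0 // mulrC; apply: le_trans (kept_count_diff _ (g0 e) gh).
rewrite /kept_count !natr_sum -sumrB; apply: ler_sum => i _.
have := @kept_mono _ M _ _ i gh.
by case: (kept (g e) i) => [->//|]; rewrite ?subrr //; case: (kept _ i); rewrite subr0.
Qed.

End Sampling.

(** * The rounding scheme *)

Section CostRank.
Context {R : realType} {V : finType} (c : pedge V -> R).

Lemma card_pedge : (#|{: pedge V}| <= #|V| ^ 2)%N.
Proof.
rewrite -mulnn -card_prod -(card_codom (f := @endpoints V)) ?max_card // => e f ef.
by apply: val_inj; rewrite /= !val_pedge /src /tgt ef.
Qed.

(** Positions in a sorted list break ties, which makes the rank injective. *)
Definition by_cost : seq (pedge V) := sort (fun e f => c e <= c f) (enum {: pedge V}).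

Definition cost_rank (e : pedge V) : nat := index e by_cost.

Lemma mem_by_cost e : e \in by_cost.
Proof. by rewrite mem_sort mem_enum. Qed.

Lemma cost_rank_inj : injective cost_rank.
Proof. by move=> e f; apply: index_inj; rewrite ?mem_by_cost. Qed.

Lemma cost_rank_mono e f : (cost_rank e <= cost_rank f)%N -> c e <= c f.
Proof.
have tot : total (fun e f => c e <= c f) by move=> a b; exact: le_total.
have tr : transitive (fun e f => c e <= c f) by move=> a b d; exact: le_trans.
have := sorted_leq_nth tr (fun a => lexx (c a)) e (sort_sorted tot (enum {: pedge V})).
move=> /(_ (cost_rank e) (cost_rank f)); rewrite !inE !nth_index ?mem_by_cost //.
by apply; rewrite -/by_cost index_mem mem_by_cost.
Qed.

Lemma cost_rank_lt e : (cost_rank e < #|{: pedge V}|)%N.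
Proof. by rewrite cardE -(size_sort (fun e f => c e <= c f)) index_mem mem_by_cost. Qed.

End CostRank.

Section Rounding.
Context {R : realType} {V : finType}.
Context (rho : pedge V -> nat) (eps gamma : R) (m : nat).
Hypotheses (rho_inj : injective rho) (rho_lt : forall e, (rho e < #|{: pedge V}|)%N).
Hypotheses (eps_ge0 : 0 <= eps) (gamma_ge0 : 0 <= gamma).
Local Notation Omega := {ffun pedge V -> 'I_m.+1}.
Implicit Types (x y : {ffun pedge V -> R}) (w : Omega) (e : pedge V) (S : {set V}).

Definition sampled x w : {set pedge V} := sample (fun e => gamma * x e) w.

Definition fails_at x w k S : bool :=
  [&& nontrivial S,
      eps * cut_weight x S < \sum_(e | crosses S e && (rho e < k)%N) x e
    & [forall e, crosses S e && (rho e < k)%N ==> (e \notin sampled x w)]].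

Definition fails x w : bool :=
  [exists k : 'I_#|{: pedge V}|.+1, exists S, fails_at x w k S].

Definition chosen x w : {set pedge V} :=
  if fails x w then [set e | x e != 0]%SET else sampled x w.

Definition tree x w := light_edges rho (chosen x w).

Lemma chosen_support x w e : (forall e, 0 <= x e) -> e \in chosen x w -> x e != 0.
Proof.
move=> x0; rewrite /chosen; case: ifP => _; rewrite inE // /kept.
by apply: contraTneq => ->; rewrite !mulr0 -leNgt ler0n.
Qed.

(** This provides [hit] for every seed, so the cost bound is deterministic: after a failure unchosen
    edges have weight 0, and otherwise the claim is the negation of [fails]. *)
Lemma chosen_hit x w k S : (forall e, 0 <= x e) -> nontrivial S ->
  (forall e, crosses S e -> (rho e < k)%N -> e \notin chosen x w) ->
  \sum_(e | crosses S e && (rho e < k)%N) x e <= eps * cut_weight x S.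
Proof.
move=> x0 ntS; rewrite /chosen; case: ifPn => [_ nS|nf nS].
  rewrite big1 ?mulr_ge0 ?sumr_ge0 // => e /andP[eS ek].
  by have := nS e eS ek; rewrite inE negbK => /eqP.
rewrite leNgt; apply: contra nf => lt; apply/existsP.
have kN : (minn k #|{: pedge V}| < #|{: pedge V}|.+1)%N by rewrite ltnS geq_minr.
have kE e : (rho e < minn k #|{: pedge V}|)%N = (rho e < k)%N.
  by rewrite leq_min rho_lt andbT.
exists (Ordinal kN); apply/existsP; exists S; apply/and3P; split=> //=.
  by under eq_bigl do rewrite kE.
by apply/forallP => e; rewrite kE; apply/implyP => /andP[]; exact: nS.
Qed.

Lemma average_fails x : (forall e, 0 <= x e) ->
  average (fun w => (fails x w)%:R) <=
  #|{: pedge V}|.+1%:R * \sum_(S | nontrivial S) expR (- (cut_weight x S * (gamma * eps))) :> R.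
Proof.
move=> x0; apply: (@le_trans _ _ (average (fun w =>
    \sum_(k < #|{: pedge V}|.+1) \sum_(S | nontrivial S) (fails_at x w k S)%:R))).
  apply: ler_average => w; case: (boolP (fails x w)) => [/existsP[k /existsP[S Sf]]|_].
    have ntS : nontrivial S by case/and3P: Sf.
    rewrite (bigD1 k) //= (bigD1 S) //= Sf -addrA lerDl addr_ge0 ?sumr_ge0 // => *.
    exact: sumr_ge0.
  by apply: sumr_ge0 => *; apply: sumr_ge0.
rewrite average_sum [leRHS]mulr_natl -[X in _ *+ X]card_ord -sumr_const.
apply: ler_sum => k _; rewrite average_sum; apply: ler_sum => S ntS.
rewrite /fails_at ntS /=; case: ltP => [lt|_] /=; last first.
  by rewrite /average big1 ?mul0r ?expR_ge0.
have g0 e : 0 <= gamma * x e by apply: mulr_ge0.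
apply: le_trans (average_rejected m (fun e => crosses S e && (rho e < k)%N) g0) _.
rewrite ler_expR lerN2 -mulr_sumr mulrCA ler_wpM2l // mulrC; exact: ltW.
Qed.

(** Stability of the forest applies unless one of the samples fails; in that case each forest still
    has at most [#|V|] edges. *)
Lemma tree_diff x y w :
  (#|symdiff (tree x w) (tree y w)| <=
   2 * #|symdiff (sampled x w) (sampled y w)| + 2 * #|V| * (fails x w + fails y w))%N.
Proof.
have trivial_bound : (#|symdiff (tree x w) (tree y w)| <= 2 * #|V|)%N.
  have le A B : (#|light_edges rho A :\: light_edges rho B| <= #|V|)%N.
    by apply: leq_trans (light_card_le rho_inj A); rewrite subset_leq_card // finset.subsetDl.
  by rewrite cardsU mul2n -addnn; apply: leq_trans (leq_subr _ _) _; rewrite leq_add ?le.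
case fx : (fails x w); last case fy : (fails y w).
- by apply: leq_trans trivial_bound _; lia.
- by apply: leq_trans trivial_bound _; lia.
by rewrite muln0 addn0 /tree /chosen fx fy; apply: light_stable.
Qed.

Lemma average_tree_diff x y p : (forall e, 0 <= x e) -> (forall e, 0 <= y e) ->
  average (fun w => (fails x w)%:R) <= p -> average (fun w => (fails y w)%:R) <= p ->
  average (fun w => #|symdiff (tree x w) (tree y w)|%:R) <=
  2 * (gamma * l1norm (x - y) + #|{: pedge V}|%:R / m.+1%:R) + 4 * #|V|%:R * p :> R.
Proof.
move=> x0 y0 px py.
apply: (@le_trans _ _ (average (fun w => 2 * #|symdiff (sampled x w) (sampled y w)|%:R +
    2 * #|V|%:R * ((fails x w)%:R + (fails y w)%:R)))).
  by apply: ler_average => w; rewrite -natrD -!natrM -natrD ler_nat tree_diff.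
rewrite averageD !averageZ averageD; apply: lerD.
  rewrite ler_pM2l //; apply: le_trans (average_sample_diff _ _ _) _.
  - by move=> e; apply: mulr_ge0.
  - by move=> e; apply: mulr_ge0.
  rewrite big_split /= lerD //; last by rewrite sumr_const mulr_natl.
  rewrite /l1norm mulr_sumr; apply: ler_sum => e _.
  by rewrite -mulrBr normrM ger0_norm // !ffunE.
have := ler_wpM2l (ler0n R #|V|) (lerD px py).
by move: (average _) (average _) => a b; lra.
Qed.

(** With this, [x 0 = 0] counts as an ordinary time step whose tree is empty. *)
Lemma tree_ffun0 w : tree 0 w = finset.set0.
Proof.
have x0 e : 0 <= (0 : {ffun pedge V -> R}) e by rewrite ffunE.
apply/setP => e; rewrite finset.in_set0; apply/negbTE/negP.
by move=> /(fintype.subsetP (light_sub rho _)) /(chosen_support x0); rewrite ffunE eqxx.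
Qed.

Lemma fails_ffun0 w : fails 0 w = false.
Proof.
apply/negbTE/negP => /existsP[k /existsP[S /and3P[_]]].
by rewrite /cut_weight !big1 ?mulr0 ?ltxx // => e _; rewrite ffunE.
Qed.

Lemma tree_spanning x w (E : {set pedge V}) : (forall e, 0 <= x e) -> eps < 1 ->
  (forall S, nontrivial S -> 1 <= cut_weight x S) ->
  (forall e, e \notin E -> x e = 0) -> spanning_tree E (tree x w).
Proof.
move=> x0 eps1 xcut xE; split; last exact: light_acyclic.
  apply/fintype.subsetP => e /(fintype.subsetP (light_sub rho _)) /(chosen_support x0).
  by apply: contraNT => /xE ->.
move=> u v; rewrite connect_light //.
by apply: (@hit_connected _ _ rho x eps) => // k S; exact: chosen_hit.
Qed.

Lemma tree_cost x w c : (forall e, 0 <= x e) -> eps < 1 ->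
  (forall S, nontrivial S -> 1 <= cut_weight x S) ->
  (forall e, 0 <= c e) -> (forall e f, (rho e <= rho f)%N -> c e <= c f) ->
  cost c (tree x w) * (1 - eps) <= 2 * \sum_e c e * x e.
Proof.
move=> x0 eps1 xcut c0 cmono.
by apply: light_cost => // k S; exact: chosen_hit.
Qed.

End Rounding.

(** * The law of the seed *)

Section UniformMeasure.
Context (R : realType) (k : nat).

(** The uniform law on 0, ..., k, carried by [nat], all of whose subsets are measurable. *)
Definition uniform_below : set nat -> \bar R :=
  mscale (k.+1%:R^-1)%:nng (msum (fun i : nat => \d_i) k.+1).

HB.instance Definition _ := Measure.on uniform_below.

Lemma uniform_below_setT : uniform_below [set: nat] = 1%E.
Proof.
rewrite /uniform_below /mscale /= /msum.
rewrite (eq_bigr (fun=> 1%:E)) => [|i _]; last exact: diracT.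
by rewrite sumEFin sumr_const card_ord -EFinM mulVf ?pnatr_eq0.
Qed.

HB.instance Definition _ :=
  @Measure_isProbability.Build _ _ R uniform_below uniform_below_setT.

Lemma expectation_uniform_below (X : nat -> R) : (forall i, 0 <= X i) ->
  'E_uniform_below[X]%E = ((\sum_(i < k.+1) X i) / k.+1%:R)%:E.
Proof.
move=> X0; pose f (i : nat) : \bar R := (X i)%:E.
have mf : measurable_fun [set: nat] f by [].
have f0 i : [set: nat]%classic i -> (0 <= f i)%E by rewrite lee_fin.
rewrite unlock /uniform_below ge0_integral_mscale // ge0_integral_measure_sum //.
under eq_bigr do rewrite integral_dirac // diracT mul1e.
by rewrite sumEFin -EFinM mulrC.
Qed.

End UniformMeasure.

Lemma average_nth (R : realType) (T : finType) (t0 : T) (k : nat) (X : T -> R) :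
  #|T| = k.+1 -> (\sum_(i < k.+1) X (nth t0 (enum T) i)) / k.+1%:R = average X.
Proof.
move=> Tk; rewrite /average Tk; congr (_ / _).
by rewrite -[RHS]big_enum [RHS](big_nth t0) [RHS]big_mkord -cardE Tk.
Qed.

(** * Numerical constants for the failure probability *)

Section FailureProbability.
Context {R : realType} (n : nat) (alpha : R).
Hypotheses (n_gt1 : (1 < n)%N) (alpha_ge1 : 1 <= alpha).
Local Notation s := ((2 * alpha + 10) * ln n%:R).

Lemma cut_parameter_small : 2 * expR (- (s / 4)) <= 1 :> R.
Proof.
have n0 : 0 < n%:R :> R by rewrite ltr0n; lia.
have ln0 : 0 <= ln n%:R :> R by rewrite ln_ge0 // ler1n; lia.
apply: (@le_trans _ _ (2 * expR (- ln n%:R))).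
  rewrite ler_pM2l // ler_expR lerN2.
  have : 0 <= (alpha - 1) * ln n%:R by rewrite mulr_ge0 // subr_ge0.
  move: (ln _) ln0 => L L0 H; lra.
by rewrite expRN lnK ?posrE // ler_pdivrMr // mul1r ler_nat.
Qed.

(** The constant 10 buys five spare powers of n: one pays for the factor [#|V|] in
    [sum_nontrivial_cuts], two for the number of rank cut-offs, and two remain for the recourse
    after a failure. *)
Lemma cut_parameter_sqr :
  (2 * expR (- (s / 4))) ^+ 2 = 4 * (n%:R `^ alpha)^-1 / n%:R ^+ 5 :> R.
Proof.
have n0 : 0 < n%:R :> R by rewrite ltr0n; lia.
have n5 : n%:R ^+ 5 = expR (5 * ln n%:R) :> R by rewrite expRM_natl lnK ?posrE.
rewrite exprMn -expRM_natl n5 /powR gt_eqF //= -!expRN -[RHS]mulrA -expRD.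
by congr (_ * expR _); [rewrite expr2 -natrM|field].
Qed.

End FailureProbability.

Section ExpectedStep.
Context {R : realType} {V : finType}.
Implicit Types (x y : {ffun pedge V -> R}).

Lemma K_facts (c : pedge V -> R) beta E x : K c beta E x ->
  [/\ forall e, 0 <= x e, forall S, nontrivial S -> 1 <= cut_weight x S,
      forall e, e \notin E -> x e = 0 &
      fractional_cost c E x = \sum_e c e * x e].
Proof.
move=> [x0 xcut xE _]; split=> // [S /andP[S0 ST]|].
  apply: le_trans (xcut S _ _) _; rewrite ?finset.proper0 ?finset.properT //.
  rewrite /cut_weight big_mkcond [leRHS]big_mkcond /=; apply: ler_sum => e _.
  by rewrite in_cut; case: (e \in E); case: (crosses S e); rewrite //= x0.
rewrite /fractional_cost big_mkcond /=; apply: eq_bigr => e _.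
by case: ifPn => // /xE ->; rewrite mulr0.
Qed.

Context (rho : pedge V -> nat) (eps gamma alpha : R) (m : nat).
Hypotheses (rho_inj : injective rho) (rho_lt : forall e, (rho e < #|{: pedge V}|)%N).
Hypotheses (eps_ge0 : 0 <= eps) (gamma_ge0 : 0 <= gamma) (alpha_ge1 : 1 <= alpha).
Hypothesis gamma_eps : gamma * eps = (2 * alpha + 14) * ln #|V|%:R.
Hypothesis V_gt1 : (1 < #|V|)%N.
Local Notation n := (#|V|%:R : R).

Let n_gt0 : 0 < n. Proof. by rewrite ltr0n; lia. Qed.
Let p_ge0 : 0 <= (n `^ alpha)^-1. Proof. by rewrite invr_ge0 powR_ge0. Qed.

Lemma average_fails_small x : (forall e, 0 <= x e) ->
  (forall S, nontrivial S -> 1 <= cut_weight x S) ->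
  average (fun w : {ffun pedge V -> 'I_m.+1} => (fails rho eps gamma x w)%:R) <=
  8 * (n `^ alpha)^-1 / n ^+ 2.
Proof.
move=> x0 xcut; apply: le_trans (average_fails rho eps m gamma_ge0 x0) _.
have := sum_nontrivial_cuts x0 xcut (cut_parameter_small V_gt1 alpha_ge1).
rewrite cut_parameter_sqr //.
have -> : (2 * alpha + 10) * ln n + 4 * ln n = gamma * eps by rewrite gamma_eps; ring.
set Z := \sum_(S | _) _ => Zle.
have N1 : #|{: pedge V}|.+1%:R <= 2 * n ^+ 2 :> R.
  rewrite -natrX -natrM ler_nat; have := card_pedge (V := V); lia.
have Z0 : 0 <= Z by apply: sumr_ge0 => *; apply: expR_ge0.
apply: le_trans (ler_wpM2r Z0 N1) _.
apply: le_trans (ler_wpM2l _ Zle) _; first by rewrite mulr_ge0 ?exprn_ge0 ?ltW.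
by rewrite le_eqVlt; apply/orP; left; apply/eqP; field; rewrite gt_eqF ?gt_eqF // powR_gt0.
Qed.

(** The zero vector is included so that the first step, from [x 0], is treated like the others. *)
Definition admissible x := x = 0 \/
  (forall e, 0 <= x e) /\ (forall S, nontrivial S -> 1 <= cut_weight x S).

Lemma admissible_fails x : admissible x -> (forall e, 0 <= x e) /\
  average (fun w : {ffun pedge V -> 'I_m.+1} => (fails rho eps gamma x w)%:R) <=
  8 * (n `^ alpha)^-1 / n ^+ 2.
Proof.
case=> [->|[x0 xcut]]; last by split=> //; apply: average_fails_small.
split=> [e|]; first by rewrite ffunE.
rewrite /average big1 => [|w _]; last by rewrite fails_ffun0.
by rewrite mul0r divr_ge0 ?exprn_ge0 ?(ltW n_gt0) ?mulr_ge0.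
Qed.

Lemma average_step x y : n `^ alpha * n ^+ 2 <= m.+1%:R ->
  admissible x -> admissible y ->
  average (fun w : {ffun pedge V -> 'I_m.+1} =>
    #|symdiff (tree rho eps gamma x w) (tree rho eps gamma y w)|%:R) <=
  2 * gamma * l1norm (x - y) + 18 / n `^ alpha.
Proof.
move=> hm /admissible_fails[x0 fx] /admissible_fails[y0 fy].
apply: le_trans (average_tree_diff rho_inj eps_ge0 gamma_ge0 x0 y0 fx fy) _.
set p := (n `^ alpha)^-1 in fx fy *; have p0 : 0 <= p := p_ge0.
have m1 : #|{: pedge V}|%:R / m.+1%:R <= p.
  rewrite ler_pdivrMr ?ltr0n //.
  apply: (@le_trans _ _ (p * (n `^ alpha * n ^+ 2))); last by rewrite ler_wpM2l.
  rewrite mulrA mulVf ?mul1r ?gt_eqF ?powR_gt0 // -natrX ler_nat; exact: card_pedge.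
have q : 4 * n * (8 * p / n ^+ 2) <= 16 * p.
  have -> : 4 * n * (8 * p / n ^+ 2) = 32 * p / n by field; rewrite gt_eqF.
  have n2 : 2 <= n by rewrite ler_nat.
  rewrite ler_pdivrMr //; have := ler_wpM2l p0 n2; lra.
rewrite -[18 / _]/(18 * p).
move: (l1norm _) (4 * n * _) q (_ / m.+1%:R) m1 => l b bp a ap.
by clearbody p; lra.
Qed.

End ExpectedStep.

Section Scheme.
Context {R : realType} {V : finType} (rho : pedge V -> nat) (eps gamma : R) (m : nat).
Local Notation Omega := {ffun pedge V -> 'I_m.+1}.

(* The seed is the rank of a threshold vector in an enumeration of Omega. *)
Definition thresholds (omega : nat) : Omega := nth [ffun=> ord0] (enum {: Omega}) omega.

(** Only the current vector and the seed matter. The law [uniform_below k] has [k + 1] points, hence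
    the predecessor. *)
Definition tree_scheme : rounding_scheme R V :=
  @RoundingScheme R V _ nat (uniform_below R #|{: Omega}|.-1)
    (fun omega h => tree rho eps gamma (last 0 h) (thresholds omega)) (fun _ _ => I).

Lemma maintainedE (x : nat -> {ffun pedge V -> R}) (omega : scheme_space tree_scheme) t :
  x 0%N = 0 -> maintained x omega t = tree rho eps gamma (x t) (thresholds omega).
Proof.
move=> x0; case: t => [|t]; first by rewrite x0 tree_ffun0.
rewrite -[LHS]/(tree rho eps gamma (last 0 [seq x i | i <- iota 1 t.+1]) (thresholds omega)).
by congr (tree _ _ _ _ _); rewrite -[X in last X]x0 last_map -nth_last size_iota nth_iota.
Qed.

Lemma expected_recourse (x : nat -> {ffun pedge V -> R}) T : x 0%N = 0 ->
  'E_(scheme_prob tree_scheme)[fun omega => recourse x T omega]%E =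
  (\sum_(1 <= t < T.+1) average (fun w : Omega =>
    #|symdiff (tree rho eps gamma (x t) w) (tree rho eps gamma (x t.-1) w)|%:R))%:E.
Proof.
move=> x0; rewrite expectation_uniform_below => [|i]; last exact: ler0n.
have Omega_gt0 : #|{: Omega}| = #|{: Omega}|.-1.+1.
  by rewrite prednK //; apply/card_gt0P; exists [ffun=> ord0].
rewrite -average_sum -(average_nth [ffun=> ord0] _ Omega_gt0); congr (_ / _)%:E.
apply: eq_bigr => i _; rewrite /recourse natr_sum; apply: eq_bigr => t _.
by rewrite !maintainedE.
Qed.

End Scheme.

(* The constants hidden in the two O's depend only on an arbitrary upper bound
   Delta on delta. *)
Theorem theorem4p7 (R : realType) (Delta : R) (hDelta : 0 < Delta) :
  exists C1 C2 : R, [/\ 0 < C1, 0 < C2 &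
    forall (V : finType) (c : pedge V -> R) (beta delta alpha : R),
      (forall e, 0 <= c e) -> 1 <= beta -> 0 < delta -> delta <= Delta ->
      1 <= alpha ->
    exists A : rounding_scheme R V,
    forall (T : nat) (E : nat -> {set pedge V})
           (x : nat -> {ffun pedge V -> R}),
      (forall t, (1 <= t <= T)%N -> edge_update (E t.-1) (E t)) ->
      (forall t, (1 <= t <= T)%N -> graph_connected (E t)) ->
      x 0%N = 0 ->
      (forall t, (1 <= t <= T)%N -> K c beta (E t) (x t)) ->
      [/\ forall (omega : scheme_space A) (t : nat), (1 <= t <= T)%N ->
            spanning_tree (E t) (maintained x omega t),
          ('E_(scheme_prob A)[fun omega => recourse x T omega] <=
            (C1 * (alpha * ln #|V|%:R / delta ^+ 2) *
               (\sum_(1 <= t < T.+1) l1norm (x t - x t.-1)) +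
             C2 * (T%:R / #|V|%:R `^ alpha))%:E)%E &
          forall (omega : scheme_space A) (t : nat), (1 <= t <= T)%N ->
            cost c (maintained x omega t) <=
              (2 + delta) * fractional_cost c (E t) (x t)]].
Proof.
(* The first constant comes from [2 * (2 * alpha + 14) <= 32 * alpha] and [(2 + delta) * delta <= (2
   + Delta) * Delta], the second from [average_step]. *)
exists (32 * ((2 + Delta) * Delta)), 18; split=> [||V c beta delta alpha c0 _ d0 dD a1].
- by rewrite !mulr_gt0 ?addr_gt0.
- by [].
pose L : R := ln #|V|%:R.
have L0 : 0 <= L.
  by rewrite /L; case: #|V| => [|k]; [rewrite ln0|rewrite ln_ge0 // ler1n].
(* The solution of [2 / (1 - eps) = 2 + delta]. *)
pose eps := delta / (2 + delta).
have d2 : 0 < 2 + delta by rewrite addr_gt0.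
have eps0 : 0 < eps by rewrite divr_gt0.
have eps1 : eps < 1 by rewrite ltr_pdivrMr // mul1r; lra.
have eps1E : 1 - eps = 2 / (2 + delta) by rewrite /eps; field; rewrite gt_eqF.
(* Here 14 is the 10 of the cut parameter plus the 4 of the contraction exponent. *)
pose gamma := (2 * alpha + 14) * L / eps.
have gamma0 : 0 <= gamma by rewrite divr_ge0 ?(ltW eps0) // mulr_ge0 //; lra.
have gammaE : gamma * eps = (2 * alpha + 14) * L by rewrite divfK ?gt_eqF.
have gamma_le : 2 * gamma <= 32 * ((2 + Delta) * Delta) * (alpha * L / delta ^+ 2).
  have -> : 2 * gamma = 2 * (2 * alpha + 14) * ((2 + delta) * delta) * (L / delta ^+ 2).
    by rewrite /gamma /eps; field; rewrite !gt_eqF.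
  have -> : 32 * ((2 + Delta) * Delta) * (alpha * L / delta ^+ 2) =
    32 * alpha * ((2 + Delta) * Delta) * (L / delta ^+ 2) by ring.
  apply: ler_wpM2r; first by rewrite divr_ge0 ?exprn_ge0 ?(ltW d0).
  apply: ler_pM; [lra|by rewrite mulr_ge0 ?(ltW d0) ?(ltW d2)|lra|].
  by apply: ler_pM; lra.
(* More than [n ^ (alpha + 2)] grid points keep the rounding error, summed over at most [n ^ 2]
   edges, below [n ^ (- alpha)]. *)
pose m := Num.truncn (#|V|%:R `^ alpha * #|V|%:R ^+ 2 : R).
pose rho := cost_rank c.
have rho_inj : injective rho := cost_rank_inj (c := c).
have rho_lt e : (rho e < #|{: pedge V}|)%N := cost_rank_lt c e.
exists (tree_scheme rho eps gamma m) => T E x Eupd _ x0 xK.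
(* Every update involves an edge, so two vertices exist as soon as there is a time step. *)
have V1 t : (1 <= t <= T)%N -> (1 < #|V|)%N.
  move=> /Eupd[e _]; have := subset_leq_card (finset.subsetT (val e)).
  by rewrite cardsT (eqP (pedge_card e)).
split.
- move=> omega t tT; rewrite maintainedE //.
  by have [x_ge0 xcut xE _] := K_facts (xK t tT); apply: tree_spanning; rewrite ?ltW.
- rewrite expected_recourse // lee_fin.
  have adm t : (t <= T)%N -> admissible (x t).
    case: t => [|t] tT; first by left.
    by have [x_ge0 xcut _ _] := K_facts (xK t.+1 tT); right.
  apply: (@le_trans _ _ (\sum_(1 <= t < T.+1)
      (2 * gamma * l1norm (x t - x t.-1) + 18 / #|V|%:R `^ alpha))).
    rewrite big_nat_cond [leRHS]big_nat_cond; apply: ler_sum => t /andP[/andP[t1 tT] _].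
    have t1T : (1 <= t <= T)%N by rewrite t1.
    apply: average_step => //; try exact: ltW.
    + exact: V1 t1T.
    + exact/ltW/truncnS_gt.
    + exact: adm.
    + by apply: adm; lia.
  rewrite big_split /= -mulr_sumr sumr_const_nat subn1 /=; apply: lerD.
    apply: ler_wpM2r; last exact: gamma_le.
    by apply: sumr_ge0 => t _; apply: sumr_ge0.
  by rewrite -[leLHS]mulr_natr mulrAC mulrA.
- move=> omega t tT; rewrite maintainedE //.
  have [x_ge0 xcut xE ->] := K_facts (xK t tT).
  have := tree_cost gamma rho_inj rho_lt (ltW eps0) (thresholds m omega) x_ge0 eps1 xcut c0
    (@cost_rank_mono _ _ c).
  rewrite eps1E mulrA ler_pdivrMr //; lra.
Qed.
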